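(* For every $n\geq 1$, $$|\mathcal{T}_{3,n}|=\frac14\,\bigl|\{\text{proper vertex } 4\text{-colorings of } \Delta_n\}\bigr|,$$ where $\mathcal{T}_{3,n}$ is the set of all interlacing triangular arrays of rank $3$ and height $n$, and $\Delta_n$ is the equilateral triangular grid graph with $n$ edges on each side.
   Context: An interlacing triangular array $T$ of rank $m$ and height $n$ is a collection $\{T^{(i)}_{j,k} : 1\le i\le m,\ 1\le j\le k\le n\}$ of elements of $\{1,\dots,m\}$ such that: (a) for each $k=1,\dots,n$, the multiset $\{T^{(i)}_{j,k} : 1\le i\le m,\ 1\le j\le k\}$ contains each of $1,\dots,m$ exactly $k$ times; (b) let $h(i,j,k)=in+j-(n+k)/2$. If $T^{(i)}_{j,k}=T^{(i')}_{j',k}=a$ with $h(i,j,k)<h(i',j',k)$, then there exist $i'',j''$ with $T^{(i'')}_{j'',k-1}=a$ and $h(i,j,k)<h(i'',j'',k-1)<h(i',j',k)$. $\mathcal{T}_{m,n}$ is the set of such arrays. $\Delta_n$ is an equilateral triangle of side $n$ subdivided into $n^2$ unit triangles, viewed as a graph on $\binom{n+2}{2}$ vertices. A proper vertex $4$-coloring is an assignment of one of $4$ fixed colors to each vertex such that adjacent vertices get different colors. *)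

(* Defs.v *)
From HB Require Import structures.
From mathcomp Require Import all_boot all_order all_algebra.

Set Implicit Arguments.
Unset Strict Implicit.
Unset Printing Implicit Defensive.

Import Order.TTheory GRing.Theory Num.Theory.

(* The index set {(i, j, k) : 1 <= i <= m, 1 <= j <= k <= n}. Ordinals start
   at 0, so the underlying triple is (i - 1, j - 1, k - 1); the projections
   [idx_i], [idx_j], [idx_k] return the 1-based indices. *)
Definition idx (m n : nat) : finType :=
  {c : 'I_m * 'I_n * 'I_n | (c.1.2 <= c.2)%N}.

Definition idx_i (m n : nat) (c : idx m n) : nat := (val c).1.1.+1.
Definition idx_j (m n : nat) (c : idx m n) : nat := (val c).1.2.+1.
Definition idx_k (m n : nat) (c : idx m n) : nat := (val c).2.+1.

Definition height (n i j k : nat) : rat :=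
  (i%:R * n%:R + j%:R - (n%:R + k%:R) / 2)%R.

Definition idx_h (m n : nat) (c : idx m n) : rat :=
  height n (idx_i c) (idx_j c) (idx_k c).

(* The entries {1, ..., m} are represented by 'I_m; the conditions only
   compare entries for equality. *)
Definition array (m n : nat) : finType := {ffun idx m n -> 'I_m}.

Definition balanced (m n : nat) (T : array m n) : bool :=
  [forall k : 'I_n, forall a : 'I_m,
     #|[set c : idx m n | (idx_k c == k.+1) && (T c == a)]| == k.+1].

(* For k = 1 there is no row k - 1, so the existential is then false. *)
Definition interlaced (m n : nat) (T : array m n) : bool :=
  [forall c : idx m n, forall c' : idx m n,
     [&& idx_k c == idx_k c', T c == T c' & (idx_h c < idx_h c')%R] ==>
     [exists c'' : idx m n,
        [&& (idx_k c'').+1 == idx_k c, T c'' == T c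
          & (idx_h c < idx_h c'' < idx_h c')%R]]].

Definition interlacing_arrays (m n : nat) : {set array m n} :=
  [set T : array m n | balanced T && interlaced T].

(* The vertex (x, y) stands for the point x e1 + y e2, where e1 and e2 are
   unit vectors at an angle of 60 degrees. *)
Definition vertex (n : nat) : finType :=
  {v : 'I_n.+1 * 'I_n.+1 | (v.1 + v.2 <= n)%N}.

Definition vx (n : nat) (v : vertex n) : nat := (val v).1.
Definition vy (n : nat) (v : vertex n) : nat := (val v).2.

(* w - v is e1, e2 or e1 - e2: one orientation for each edge direction. *)
Definition step (n : nat) (v w : vertex n) : bool :=
  [|| (vx w == (vx v).+1) && (vy w == vy v),
      (vx w == vx v) && (vy w == (vy v).+1)
    | (vx w == (vx v).+1) && (vy v == (vy w).+1)].

Definition adj (n : nat) : rel (vertex n) :=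
  fun v w => step v w || step w v.

Definition proper_colorings (q n : nat) : {set {ffun vertex n -> 'I_q}} :=
  [set f : {ffun vertex n -> 'I_q} |
     [forall v, forall w, adj v w ==> (f v != f w)]].

(* Main.v *)
Require Import Defs.
From mathcomp Require Import all_boot all_order all_algebra.
From mathcomp Require Import zify lra.

Set Implicit Arguments.
Unset Strict Implicit.
Unset Printing Implicit Defensive.

Import Order.TTheory GRing.Theory Num.Theory.

(* Identify the three letters with the nonzero vectors of F_2^2. The difference
   of a proper 4-coloring along each edge labels the edges of the triangular grid
   so that every unit triangle carries all three letters, and a coloring is
   recovered from this labelling and the color of one vertex. It remains to match
   labellings with arrays.

   Merge rows k and k-1 of an array by height: each block reads
   b_1 t_1 b_2 ... t_(k-1) b_k. Being balanced and interlaced means that every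
   letter occurs alternately in row k and in row k-1. Call a letter "on" when one
   more b than t has been read. In block 1 the on-set is empty or a singleton, so
   t_j = b_j; in block 3 at most one letter is off, so t_j = b_(j+1); in block 2
   the on-set alternates between one and two letters, which is the rule for
   filling a horizontal strip of the grid, with b on its lower side, t on its
   upper side and the sum of the on-set on the slanted edges. Hence the blocks are
   the left side, the horizontal lines and the right side of the labelled grid. *)

(** * Letters as the nonzero vectors of F_2^2 *)

Local Notation V := (bool * bool)%type.

Definition phi (a : 'I_3) : V := (0 < a, a != 1 :> nat).

Definition psi (v : V) : 'I_3 :=
  match v with
  | (false, _) => inord 0 | (true, false) => inord 1 | (true, true) => inord 2
  end.

Lemma ord3P (a : 'I_3) : [\/ a = inord 0, a = inord 1 | a = inord 2].
Proof.
case: a => [[|[|[|//]]]] ha; [constructor 1 | constructor 2 | constructor 3];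
  by apply: val_inj; rewrite /= inordK.
Qed.

Lemma phi_neq0 (a : 'I_3) : phi a != 0%R.
Proof. by case: (ord3P a) => ->; rewrite /phi inordK. Qed.

Lemma phiK : cancel phi psi.
Proof. by move=> a; case: (ord3P a) => ->; rewrite /phi inordK. Qed.

Lemma psiK (v : V) : v != 0%R -> phi (psi v) = v.
Proof. by case: v => [[] []] //= _; rewrite /phi inordK. Qed.

Lemma phi_inj : injective phi. Proof. exact: can_inj phiK. Qed.

Lemma addvv (v : V) : (v + v = 0)%R. Proof. by case: v => [[] []]. Qed.

Lemma oppv (v : V) : (- v = v)%R. Proof. by case: v => [[] []]. Qed.

Lemma sum_ord3 (M : nmodType) (F : 'I_3 -> M) :
  (\sum_a F a = F (inord 0) + F (inord 1) + F (inord 2))%R.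
Proof.
rewrite !big_ord_recl big_ord0 GRing.addr0 GRing.addrA.
by congr (F _ + F _ + F _)%R; apply: val_inj; rewrite /= inordK.
Qed.

(** The only nontrivial relation among the letters is that all three sum to zero. *)
Lemma onset_neq0 (e : 'I_3 -> nat) :
  (forall a, e a <= 1) -> 1 <= \sum_a e a <= 2 -> (\sum_a phi a *+ e a != 0)%R.
Proof.
move=> e1; rewrite (sum_ord3 e) sum_ord3 /phi !inordK //.
have:= e1 (inord 0); have:= e1 (inord 1); have:= e1 (inord 2).
by case: (e _) => [|[|//]] _; case: (e _) => [|[|//]] _; case: (e _) => [|[|//]] _.
Qed.

(** Here [e] marks the two letters other than [c], and all three letters sum to zero. *)
Lemma onset_pred (e : 'I_3 -> nat) (c : 'I_3) :
  (forall a, e a + (c == a) = 1) -> (\sum_a phi a *+ e a = phi c)%R.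
Proof.
move=> H; rewrite sum_ord3.
have:= H (inord 0); have:= H (inord 1); have:= H (inord 2).
case: (ord3P c) => ->; rewrite /phi -!val_eqE /= !inordK //=;
by case: (e _) => [|[|//]] //= _; case: (e _) => [|[|//]] //= _; case: (e _) => [|[|//]].
Qed.

(** * Prefix counts in the merged word of two consecutive rows *)

Section Rows.

Variable t : nat -> nat -> nat -> 'I_3.

(* Here [t i j k] is the paper's T^(i+1)_(j+1,k): [k] starts at 1. *)
Definition word k r := t (r %/ k) (r %% k) k.

(* In the merged order, the entries of row [k.-1] lie between consecutive entries
   of row [k], except that nothing lies after the last entry of a block. *)
Definition slot k (a : 'I_3) r : bool :=
  (r %% k < k.-1) && (t (r %/ k) (r %% k) k.-1 == a).

Definition Bn k a R := \sum_(0 <= r < R) (word k r == a).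
Definition Qn k a R := \sum_(0 <= r < R) slot k a r.

Lemma wordE k i j : j < k -> word k (i * k + j) = t i j k.
Proof.
by move=> jk; rewrite /word divnMDl ?modnMDl ?divn_small ?modn_small ?addn0 //; lia.
Qed.

Lemma slotE k a i j : j < k ->
  slot k a (i * k + j) = (j < k.-1) && (t i j k.-1 == a).
Proof.
by move=> jk; rewrite /slot divnMDl ?modnMDl ?divn_small ?modn_small ?addn0 //; lia.
Qed.

Lemma sum_blocks (M : nmodType) (F : nat -> M) i k x :
  (\sum_(0 <= r < i * k + x) F r =
   \sum_(0 <= i' < i) \sum_(0 <= j < k) F (i' * k + j)%N
   + \sum_(0 <= j < x) F (i * k + j)%N)%R.
Proof.
have shift a b : (\sum_(a <= j < a + b) F j = \sum_(0 <= j < b) F (a + j)%N)%R.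
  by rewrite -{1}[a]add0n big_addn addKn; apply: eq_bigr => j _; rewrite addnC.
rewrite (@big_cat_nat _ _ _ (i * k)) ?leq_addr //= big_nat_mul shift.
by congr (_ + _)%R; apply: eq_bigr => i' _; rewrite mulSnr shift.
Qed.

(* Deleting the last position of each block of [k] leaves blocks of [k.-1]. *)
Lemma sum_skip (M : nmodType) (F : nat -> nat -> M) i k x : 0 < k -> x <= k.-1 ->
  (\sum_(0 <= r < i * k + x) (F (r %/ k)%N (r %% k)%N *+ (r %% k < k.-1)%N)
   = \sum_(0 <= r < i * k.-1 + x) F (r %/ k.-1)%N (r %% k.-1)%N)%R.
Proof.
case: k => // k _ /= xk; rewrite !sum_blocks.
congr (_ + _)%R.
  apply: eq_bigr => i' _; rewrite big_nat_recr //= divnMDl // modnMDl.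
  rewrite divn_small // modn_small // ltnn mulr0n GRing.addr0.
  apply: eq_big_nat => j /= jk.
  rewrite !modnMDl !divnMDl; try lia.
  by rewrite !divn_small ?modn_small; try lia; rewrite jk !addn0.
apply: eq_big_nat => j /= jx.
rewrite !modnMDl !divnMDl; try lia.
rewrite !divn_small ?modn_small; try lia.
by rewrite (_ : j < k) ?addn0 ; try lia.
Qed.

Lemma Qn_skip k a i x : 0 < k -> x <= k.-1 -> Qn k a (i * k + x) = Bn k.-1 a (i * k.-1 + x).
Proof.
move=> k0 xk; have:= @sum_skip nat (fun i j => nat_of_bool (t i j k.-1 == a)) i k x k0 xk.
rewrite /Qn /Bn => <-; apply: eq_bigr => r _; rewrite /slot.
by case: (_ < _); rewrite ?mulr1n ?mulr0n.
Qed.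

Lemma sum_Bn k R : \sum_a Bn k a R = R.
Proof.
rewrite /Bn exchange_big /= -[RHS]subn0 -[RHS]muln1 -sum_nat_const_nat.
apply: eq_bigr => r _; rewrite (bigD1 (word k r)) //= eqxx big1 // => a.
by rewrite eq_sym => /negbTE->.
Qed.

Lemma div_modS k r : 0 < k ->
  (r.+1 %/ k = r %/ k /\ r.+1 %% k = (r %% k).+1 /\ r %% k < k.-1) \/
  (r.+1 %/ k = (r %/ k).+1 /\ r.+1 %% k = 0 /\ r %% k = k.-1).
Proof.
move=> k0; have:= ltn_pmod r k0; have:= divn_eq r k.
move: (r %/ k) (r %% k) => q m -> mk.
case: (ltnP m k.-1) => h; [left | right].
  by rewrite -addnS divnMDl // modnMDl divn_small ?modn_small; lia.
have {h}-> : m = k.-1 by lia.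
by rewrite -addnS prednK // -mulSnr mulnK // modnMl.
Qed.

(** Each of the [R %/ k] complete blocks contains exactly one empty slot. *)
Lemma sum_Qn k R : 0 < k -> \sum_a Qn k a R + R %/ k = R.
Proof.
move=> k0; elim: R => [|R IH]; first by rewrite div0n big1 // => a _; rewrite /Qn big_nil.
under eq_bigr do rewrite /Qn big_nat_recr //=.
rewrite big_split /= -[X in X + _ + _]/(\sum_a Qn k a R).
have -> : \sum_a slot k a R = (R %% k < k.-1).
  rewrite /slot (bigD1 (t (R %/ k) (R %% k) k.-1)) //= eqxx andbT big1 ?addn0 // => a.
  by rewrite eq_sym => /negbTE->; rewrite andbF.
by case: (div_modS R k0) => [[-> [_ ->]]|[-> [_ ->]]]; lia.
Qed.

(** The excess of [a] in row [k] over row [k.-1] stays 0 or 1. It can only rise at a letter of row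
    [k] and fall at a slot, so it is tested just before and just after each letter of row [k]. *)
Definition alternating k := forall a r, r < 3 * k ->
  Qn k a r <= Bn k a r /\ Bn k a r.+1 <= (Qn k a r).+1.

Definition good_row k :=
  (forall a, Bn k a (3 * k) = k) /\
  (forall a r r', r < r' < 3 * k -> word k r = a -> word k r' = a ->
     exists2 l, r <= l < r' & slot k a l).

End Rows.

(** * Interlacing as alternation of prefix counts *)

Lemma gap_count (P Q : pred nat) m n : m <= n ->
  (forall r r', m <= r -> r < r' <= n -> P r -> P r' -> exists2 l, r <= l < r' & Q l) ->
  \sum_(m <= r < n.+1) P r <= (\sum_(m <= r < n) Q r).+1.
Proof.
move=> mn H.
(* The induction also needs, in case of equality, a [P] with no later [Q]: a further [P] at [n.+1]
   then forces a [Q] at [n] itself. *)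
suff [] : \sum_(m <= r < n.+1) P r <= (\sum_(m <= r < n) Q r).+1 /\
  (\sum_(m <= r < n.+1) P r = (\sum_(m <= r < n) Q r).+1 ->
   exists2 r, m <= r <= n & P r /\ (forall l, r <= l < n -> ~~ Q l)) by [].
elim: n mn H => [|n IH] mn H.
  have -> : m = 0 by lia.
  rewrite big_nat1 big_geq //; split; first by case: (P 0).
  by case E: (P 0) => // _; exists 0.
case: (ltngtP m n.+1) mn => // mn _; last first.
  rewrite mn big_nat1 big_geq //; split; first by case: (P _).
  by case E: (P _) => // _; exists n.+1; rewrite ?leqnn //; split => // l; lia.
case: (IH mn); [by move=> r r' mr rr'; apply: H; lia | move=> le1 pend].
rewrite [X in _ <= X.+1](big_nat_recr n) /=; last lia.
rewrite [X in _ = X.+1 -> _](big_nat_recr n) /=; last lia.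
rewrite (big_nat_recr n.+1) /=; last lia.
move: le1 pend; set p := \sum_(m <= r < n.+1) _; set q := \sum_(m <= r < n) _ => le1 pend.
case Qn: (Q n); case Pn: (P n.+1) => /=.
- split; first lia.
  by move=> _; exists n.+1; [lia | split => // l; lia].
- by split; lia.
- case: (ltngtP p q.+1) le1 => // pq _.
    split; first lia.
    by move=> _; exists n.+1; [lia | split => // l; lia].
  case: (pend pq) => r mr [Pr Nr].
  have [l lr Ql] := H r n.+1 ltac:(lia) ltac:(lia) Pr Pn.
  case: (ltnP l n) => ln; first by have := Nr l; rewrite Ql => /(_ ltac:(lia)).
  have E : l = n by lia.
  by rewrite -E Ql in Qn.
- rewrite !addn0; split => // pq; case: (pend pq) => r mr [Pr Nr].
  exists r; first lia.
  split => // l lr; case: (ltnP l n) => ln; first by apply: Nr; lia.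
  have -> : l = n by lia.
  by rewrite Qn.
Qed.

(** [gap_count] on a prefix bounds the excess above by 1. On the suffix it bounds the prefix excess
    below by 0, since the total excess is [k - k.-1 = 1]. *)
Lemma good_alternating t k : 0 < k -> good_row t k -> good_row t k.-1 -> alternating t k.
Proof.
move=> k0 [bal gap] [bal' _] a r rk.
have gap' r1 r2 : r1 < r2 < 3 * k -> word t k r1 == a -> word t k r2 == a ->
    exists2 l, r1 <= l < r2 & slot t k a l.
  by move=> h /eqP h1 /eqP h2; apply: gap h h1 h2.
have Qtot : Qn t k a (3 * k) = k.-1.
  by have:= @Qn_skip t k a 3 0 k0 (leq0n _); rewrite !addn0 bal'.
split; last first.
  by apply: gap_count => // r1 r2 _ h; apply: gap'; lia.
have := @gap_count (fun r => word t k r == a) (slot t k a) r (3 * k).-1 ltac:(lia).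
rewrite prednK; last lia.
move=> /(_ (fun r1 r2 _ h => gap' r1 r2 ltac:(lia))).
move: (bal a) Qtot; rewrite /Bn /Qn.
rewrite !(@big_cat_nat _ _ _ r 0 (3 * k)) //=; try lia.
have -> : 3 * k = (3 * k).-1.+1 by lia.
rewrite !(big_nat_recr (3 * k).-1 r) /=; lia.
Qed.

(** Without such a slot [Qn] would stay fixed while [Bn] rises by two, more than alternation
    allows. *)
Lemma alternating_gap t k a r r' : alternating t k -> r < r' < 3 * k ->
  word t k r = a -> word t k r' = a -> exists2 l, r <= l < r' & slot t k a l.
Proof.
move=> alt rr' wr wr'.
have [q1 _] := alt a r ltac:(lia).
have [_] := alt a r' ltac:(lia).
rewrite {1}/Bn big_nat_recr //= wr' eqxx -/(Bn t k a r') => b2.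
case: (boolP (has (slot t k a) (index_iota r r'))) => [/hasP[l]|/hasPn none].
  by rewrite mem_index_iota => lr sl; exists l.
have E : Qn t k a r' = Qn t k a r.
  rewrite /Qn (@big_cat_nat _ _ _ r 0 r') //=; last lia.
  rewrite -[RHS]addn0; congr (_ + _); rewrite big_nat big1 // => l h.
  by rewrite (negbTE (none l _)) // mem_index_iota.
have : Bn t k a r < Bn t k a r'.
  rewrite /Bn (@big_cat_nat _ _ _ r 0 r') //=; last lia.
  by rewrite (@big_ltn _ _ _ r r') ?wr ?eqxx; lia.
lia.
Qed.

Lemma good_row0 t : good_row t 0.
Proof. by split => [a|a r r']; [rewrite /Bn muln0 big_nil | rewrite muln0 ltn0 andbF]. Qed.

Lemma BnS t k a r : Bn t k a r.+1 = Bn t k a r + (word t k r == a).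
Proof. by rewrite /Bn big_nat_recr. Qed.

Lemma QnS t k a r : Qn t k a r.+1 = Qn t k a r + slot t k a r.
Proof. by rewrite /Qn big_nat_recr. Qed.

(** * The on-set and its size in each block *)

Section OnSet.

Variables (t : nat -> nat -> nat -> 'I_3) (k : nat).
Hypotheses (k0 : 0 < k) (alt : alternating t k).

(* The truncated subtractions are exact when the row is alternating. *)
Definition onset r a := Bn t k a r - Qn t k a r.
Definition onsetS r a := Bn t k a r.+1 - Qn t k a r.

Lemma onset_le1 r a : r < 3 * k -> onset r a <= 1.
Proof. by move=> rk; have [] := alt a rk; rewrite BnS /onset; lia.
Qed.

Lemma onsetS_le1 r a : r < 3 * k -> onsetS r a <= 1.
Proof. by move=> rk; have [] := alt a rk; rewrite /onsetS; lia.
Qed.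

Lemma Bn_onset r a : r < 3 * k -> Bn t k a r = Qn t k a r + onset r a.
Proof. by move=> rk; have [] := alt a rk; rewrite /onset; lia.
Qed.

Lemma Bn_onsetS r a : r < 3 * k -> Bn t k a r.+1 = Qn t k a r + onsetS r a.
Proof. by move=> rk; have [] := alt a rk; rewrite /onsetS BnS; lia.
Qed.

(** Each complete block leaves one more letter on, as no slot follows its last letter. With blocks
    numbered from 0, block [i] has [i] letters on before each [b] and [i + 1] after it. *)
Lemma sum_onset r : r < 3 * k -> \sum_a onset r a = r %/ k.
Proof.
move=> rk; have := sum_Bn t k r; have := sum_Qn t r k0.
under [in X in _ -> X -> _]eq_bigr => a _ do rewrite (Bn_onset a rk).
by rewrite big_split /=; lia.
Qed.

Lemma sum_onsetS r : r < 3 * k -> \sum_a onsetS r a = (r %/ k).+1.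
Proof.
move=> rk; have := sum_Bn t k r.+1; have := sum_Qn t r k0.
under [in X in _ -> X -> _]eq_bigr => a _ do rewrite (Bn_onsetS a rk).
by rewrite big_split /=; lia.
Qed.

Lemma Bn_block0 r a : r < k -> Bn t k a r = Qn t k a r.
Proof.
move=> rk; have rk3 : r < 3 * k by lia.
rewrite Bn_onset //; have := sum_onset rk3; rewrite divn_small // sum_ord3.
by case: (ord3P a) => ->; lia.
Qed.

Lemma Bn_block2 r a : 2 * k <= r < 3 * k -> Bn t k a r.+1 = (Qn t k a r).+1.
Proof.
move=> rk; have rk3 : r < 3 * k by lia.
rewrite Bn_onsetS //; have := sum_onsetS rk3.
have -> : r %/ k = 2.
  by rewrite (_ : r = 2 * k + (r - 2 * k)) ?divnMDl ?divn_small; lia.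
rewrite sum_ord3.
have := onsetS_le1 (inord 0) rk3; have := onsetS_le1 (inord 1) rk3.
have := onsetS_le1 (inord 2) rk3.
by case: (ord3P a) => ->; lia.
Qed.

(** The on-set is empty before [b] and after its slot, so the slot turns off the letter just turned
    on. *)
Lemma block0_const j : j < k.-1 -> t 0 j k.-1 = t 0 j k.
Proof.
move=> jk; have := Bn_block0 (t 0 j k) (ltac:(lia) : j.+1 < k).
rewrite BnS QnS -(Bn_block0 _ (ltac:(lia) : j < k)).
have jk' : j < k by lia.
have := wordE t 0 jk'; have := slotE t (t 0 j k) 0 jk'; rewrite mul0n add0n => -> ->.
by rewrite eqxx jk /=; case: eqP => //; lia.
Qed.

(** All letters are on just after each [b] of the last block, so the next [b] restores what the slot
    turned off. *)
Lemma block2_shift j : j < k.-1 -> t 2 j k.-1 = t 2 j.+1 k.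
Proof.
move=> jk; have := Bn_block2 (t 2 j.+1 k) (ltac:(lia) : 2 * k <= (2 * k + j).+1 < 3 * k).
rewrite BnS QnS (Bn_block2 _ (ltac:(lia) : 2 * k <= 2 * k + j < 3 * k)).
rewrite -addnS wordE; last lia.
rewrite slotE; last lia.
by rewrite eqxx jk /=; case: eqP => //; lia.
Qed.

(** The empty slot changes nothing, and the first [b] of the last block completes the on-set, so it
    is the one letter that was off. *)
Lemma onset_end_block1 a : onsetS (2 * k).-1 a + (t 2 0 k == a) = 1.
Proof.
have Q : Qn t k a (2 * k) = Qn t k a (2 * k).-1.
  have {1}-> : 2 * k = (2 * k).-1.+1 by lia.
  rewrite QnS (_ : (2 * k).-1 = 1 * k + k.-1); last lia.
  by rewrite slotE ?ltnn ?addn0 //; lia.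
have := Bn_block2 a (ltac:(lia) : 2 * k <= 2 * k < 3 * k).
rewrite BnS {}Q -{1}(@prednK (2 * k)); last lia.
rewrite Bn_onsetS; last lia.
have -> : word t k (2 * k) = t 2 0 k by rewrite -(wordE t 2 k0) addn0.
by lia.
Qed.

End OnSet.

(** * From an array to a proper coloring of the grid *)

Lemma sum_phi t k R :
  (\sum_(0 <= r < R) phi (word t k r) = \sum_a phi a *+ Bn t k a R)%R.
Proof.
rewrite /Bn; under [RHS]eq_bigr => a _ do rewrite -sumrMnr.
rewrite exchange_big /=; apply: eq_bigr => r _.
by rewrite (bigD1 (word t k r)) //= eqxx big1 ?GRing.addr0 // => a; rewrite eq_sym => /negbTE->.
Qed.

Lemma phi_mulr2n a q e : (phi a *+ (q + e) + phi a *+ q = phi a *+ e)%R.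
Proof. by rewrite mulrnDr GRing.addrAC addvv GRing.add0r. Qed.

Lemma eq_addv (u v : V) : (u == v) = (u + v == 0)%R.
Proof. by rewrite GRing.addr_eq0 oppv. Qed.

(* [g k x] is the color of the [x]-th vertex from the left on the horizontal line
   with [k] edges; line [0] is the top corner. *)
Definition proper_grid (g : nat -> nat -> V) n := forall k x, x < k <= n ->
  [/\ g k x != g k x.+1, g k x != g k.-1 x & g k x.+1 != g k.-1 x].

Definition edge_labels (t : nat -> nat -> nat -> 'I_3) (g : nat -> nat -> V) n :=
  forall k j, j < k <= n ->
  [/\ phi (t 0%N j k) = g j.+1 0%N + g j 0%N,
      phi (t 1%N j k) = g k j.+1 + g k j
    & phi (t 2%N j k) = g (k - j)%N (k - j)%N + g (k - j).-1%N (k - j).-1%N]%R.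

Section ArrayToGrid.

Variables (t : nat -> nat -> nat -> 'I_3) (n : nat) (c : V).
Hypothesis good : forall k, k <= n -> good_row t k.

(* The labels along the left side down to line [k], then along that line. *)
Definition grid k x : V := (c + \sum_(0 <= r < (k + x)%N) phi (word t k r))%R.

Lemma good_alt k : 0 < k <= n -> alternating t k.
Proof. by move=> kn; apply: good_alternating; [lia | apply: good; lia ..]. Qed.

(** The constant [c] cancels, and block 0 of row [k.-1] with [x] further letters fills exactly the
    first [k + x] slots. *)
Lemma grid_diff k x x' : 0 < k <= n -> x <= k.-1 ->
  (grid k x' + grid k.-1 x =
   \sum_a (phi a *+ Bn t k a (k + x')%N + phi a *+ Qn t k a (k + x)%N))%R.
Proof.
move=> kn xk; rewrite /grid !sum_phi GRing.addrACA addvv GRing.add0r big_split /=.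
congr (_ + _)%R; apply: eq_bigr => a _.
by have := @Qn_skip t k a 1 x ltac:(lia) xk; rewrite !mul1n => ->.
Qed.

Lemma grid_diff0 k x : 0 < k <= n -> x < k ->
  (grid k x + grid k.-1 x = \sum_a phi a *+ onset t k (k + x)%N a)%R.
Proof.
move=> kn xk; rewrite grid_diff //; last lia.
by apply: eq_bigr => a _; rewrite (Bn_onset _ (good_alt kn)) ?phi_mulr2n //; lia.
Qed.

Lemma grid_diffS k x : 0 < k <= n -> x < k ->
  (grid k x.+1 + grid k.-1 x = \sum_a phi a *+ onsetS t k (k + x)%N a)%R.
Proof.
move=> kn xk; rewrite grid_diff //; last lia.
by apply: eq_bigr => a _; rewrite addnS (Bn_onsetS _ (good_alt kn)) ?phi_mulr2n //; lia.
Qed.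

Lemma gridS k x : x < k -> grid k x.+1 = (grid k x + phi (t 1%N x k))%R.
Proof.
move=> xk; rewrite /grid addnS big_nat_recr //= GRing.addrA.
by rewrite -(wordE t 1 xk) mul1n.
Qed.

(** A horizontal difference is a letter. The slanted ones are on-set sums in the middle block, of
    one letter before a [b] and two after it. *)
Lemma grid_proper : proper_grid grid n.
Proof.
move=> k x xk; have kn : 0 < k <= n by lia.
have xk' : x < k by lia.
have dv : (k + x) %/ k = 1 by rewrite -{1}[k]mul1n divnMDl ?divn_small; lia.
rewrite (eq_addv _ (grid k x.+1)) (eq_addv _ (grid k.-1 x)) (eq_addv (grid k x.+1)).
rewrite grid_diff0 // grid_diffS // gridS // GRing.addrA addvv GRing.add0r.
have k0 : 0 < k by lia.
have k3 : k + x < 3 * k by lia.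
have alt := good_alt kn.
split; first exact: phi_neq0.
  by apply: onset_neq0 => [a|]; [exact: onset_le1 | rewrite sum_onset ?dv].
by apply: onset_neq0 => [a|]; [exact: onsetS_le1 | rewrite sum_onsetS ?dv].
Qed.

Lemma block0E k j : j < k <= n -> t 0 j k = t 0 j j.+1.
Proof.
elim: k => [|k IH] jk; first lia.
case: (ltngtP j k) => h; [|lia|by rewrite h].
have alt := @good_alt k.+1 ltac:(lia).
by rewrite -(block0_const (ltn0Sn k) alt (ltac:(lia) : j < k)) /= IH //; lia.
Qed.

Lemma block2E k j : j < k <= n -> t 2 j k = t 2 0 (k - j).
Proof.
elim: k j => [|k IH] [|j] jk; rewrite ?subn0 //.
have alt := @good_alt k.+1 ltac:(lia).
by rewrite -(block2_shift (ltn0Sn k) alt (ltac:(lia) : j < k)) /= IH ?subSS //; lia.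
Qed.

(** The two values come from different rows, whose blocks 0 agree up to the extra last letter of the
    longer one. *)
Lemma grid_left k : 0 < k <= n -> (phi (t 0%N k.-1 k) = grid k 0%N + grid k.-1 0%N)%R.
Proof.
case: k => // k kn; rewrite /grid /= !addn0 big_nat_recr //=.
rewrite GRing.addrACA addvv GRing.add0r GRing.addrAC.
have wE l r : r < l -> word t l r = t 0 r l.
  by move=> rl; have := wordE t 0 rl; rewrite mul0n.
rewrite wE // (_ : \sum_(0 <= i < k) _ = \sum_(0 <= r < k) phi (word t k r))%R.
  by rewrite addvv GRing.add0r.
apply: eq_big_nat => r /= rk; rewrite !wE; try lia.
by rewrite -(block0_const (ltn0Sn k) (good_alt kn) rk).
Qed.

(** The on-set at the right end of line [k] lacks only the first letter of the last block, hence
    sums to it. *)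
Lemma grid_right k : 0 < k <= n -> (phi (t 2%N 0%N k) = grid k k + grid k.-1 k.-1)%R.
Proof.
move=> kn; rewrite -{3}[k]prednK; last lia.
rewrite grid_diffS //; last lia.
rewrite (_ : k + k.-1 = (2 * k).-1); last lia.
symmetry; apply: onset_pred => a.
by apply: onset_end_block1 (good_alt kn) _; lia.
Qed.

Lemma grid_labels : edge_labels t grid n.
Proof.
move=> k j jk; split.
- by rewrite block0E // (@grid_left j.+1) //; lia.
- by rewrite gridS; [rewrite GRing.addrAC addvv GRing.add0r | lia].
- by rewrite block2E // grid_right //; lia.
Qed.

Lemma grid00 : grid 0 0 = c.
Proof. by rewrite /grid big_nil GRing.addr0. Qed.

End ArrayToGrid.

(** * From a proper coloring of the grid to an array *)

Lemma eq_phi (b a : 'I_3) : (b == a) = (phi b == phi a).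
Proof. by rewrite (inj_eq phi_inj). Qed.

Lemma third_letter (v s u : V) : v != 0%R -> s != 0%R -> u != 0%R -> s != u ->
  (v == s) + (u == v) = (v != (s + u)%R).
Proof. by case: v s u => [[] []] [[] []] [[] []]. Qed.

(** The sides of a unit triangle carry the three letters: with [p + q] on, reading [p' + p] leaves
    only [p' + q] off. *)
Lemma strip_step (p p' q : V) a : p != p' -> p != q -> p' != q ->
  (phi a == (p + q)%R) + ((p' + p)%R == phi a) = (phi a != (p' + q)%R).
Proof.
move=> pp' pq p'q; rewrite third_letter ?phi_neq0 //.
- by rewrite (_ : p + q + (p' + p) = p' + q)%R //; move: p p' q {pp' pq p'q} => [[] []] [[] []] [[] []].
- by rewrite -eq_addv.
- by rewrite -eq_addv eq_sym.
- by rewrite GRing.addrC (inj_eq (GRing.addIr p)) eq_sym.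
Qed.

Section GridToArray.

Variables (t : nat -> nat -> nat -> 'I_3) (g : nat -> nat -> V) (n : nat).
Hypotheses (gP : proper_grid g n) (tg : edge_labels t g n).

(* Whether [a] is on after [r] letters of each row. In the last block the letter
   that is off is the next right-side label. *)
Definition indicator k a r : bool :=
  let x := r %% k in
  match r %/ k with
  | 0 => false
  | 1 => phi a == (g k x + g k.-1 x)%R
  | 2 => phi a != (g (k - x)%N (k - x)%N + g (k - x).-1%N (k - x).-1%N)%R
  | _ => true
  end.

Lemma indicator_step k a r : 0 < k <= n -> r < 3 * k ->
  indicator k a r + (word t k r == a) = slot t k a r + indicator k a r.+1
  /\ indicator k a r + (word t k r == a) <= 1.
Proof.
move=> kn rk; rewrite /indicator /word /slot.
have k0 : 0 < k by lia.
have : r %/ k < 3 by rewrite ltn_divLR.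
have := ltn_pmod r k0.
have := div_modS r k0.
move: (r %/ k) (r %% k) => i x div_mod xk i3.
have [t0 t1 t2] := tg (ltac:(lia) : x < k <= n).
have [pp' pq p'q] := gP (ltac:(lia) : x < k <= n).
rewrite !eq_phi.
case: div_mod => [[-> [-> lt]]|[-> [-> xE]]].
  have [t0' t1' t2'] := tg (ltac:(lia) : x < k.-1 <= n).
  rewrite lt; case: i i3 => [|[|[|//]]] _ /=.
  - by rewrite t0 t0' addn0; split; case: eqP.
  (* Two unit triangles share the edge from vertex [x.+1] of line [k] to vertex [x] of line [k.-1].
     Crossing the first turns the letter [b] on, crossing the second turns [t] off. *)
  - have [_ p'q' _] := gP (ltac:(lia) : x.+1 < k <= n).
    have [qq _ _] := gP (ltac:(lia) : x < k.-1 <= n).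
    rewrite t1 t1' strip_step //.
    split; last by case: eqP.
    rewrite eq_sym in qq; rewrite eq_sym in p'q'; rewrite eq_sym in p'q.
    rewrite [X in phi a != X]GRing.addrC -(strip_step a qq p'q' p'q).
    by rewrite addnC [X in X == phi a]GRing.addrC [X in phi a == X]GRing.addrC.
  - rewrite t2 t2' (_ : k.-1 - x = k - x.+1); last lia.
    rewrite (_ : (k - x).-1 = k - x.+1); last lia.
    rewrite ![phi a == _]eq_sym.
    by split; case: eqP => //=; case: eqP.
(* At the last letter of a block the slot is empty, and [indicator] passes to the formula of the
   next block. *)
have {}xE : x = k.-1 by [].
rewrite xE ltnn /=; rewrite xE in t0 t1 t2 pp' pq p'q.
rewrite prednK // in t0 t1 t2 pp' pq p'q.
case: i i3 => [|[|[|//]]] _ /=.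
- by rewrite t0 eq_sym; split; case: eqP.
- rewrite t1 strip_step // subn0; split; [by [] | by case: eqP].
- by rewrite t2 eq_sym; split; case: eqP.
Qed.

Lemma Bn_indicator k a r : 0 < k <= n -> r <= 3 * k ->
  Bn t k a r = Qn t k a r + indicator k a r.
Proof.
move=> kn; elim: r => [|r IH] rk.
  by rewrite /Bn /Qn !big_nil /indicator div0n.
have [E _] := @indicator_step k a r kn rk.
by rewrite BnS QnS IH; lia.
Qed.

Lemma grid_alternating k : 0 < k <= n -> alternating t k.
Proof.
move=> kn a r rk; have [_ le] := @indicator_step k a r kn rk.
by rewrite BnS Bn_indicator //; lia.
Qed.

Lemma grid_good k : k <= n -> good_row t k.
Proof.
elim: k => [|k IH] kn; first exact: good_row0.
split=> [a|a r r']; last by apply: alternating_gap; apply: grid_alternating.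
(* The quotient is now 3, the default case in which every letter is on. *)
rewrite Bn_indicator // /indicator mulnK //.
have := @Qn_skip t k.+1 a 3 0 isT (leq0n _); rewrite !addn0 /= => ->.
by have [-> _] := IH (ltnW kn); rewrite addn1.
Qed.

End GridToArray.

Lemma grid_unique t g g' n : edge_labels t g n -> edge_labels t g' n -> g 0 0 = g' 0 0 ->
  forall k x, x <= k <= n -> g k x = g' k x.
Proof.
move=> tg tg' e00.
have left k : k <= n -> g k 0 = g' k 0.
  elim: k => [//|k IH] kn.
  have [e _ _] := tg k.+1 k ltac:(lia); have [e' _ _] := tg' k.+1 k ltac:(lia).
  by move: e; rewrite e' IH ?(ltnW kn) // => /GRing.addIr.
move=> k; elim=> [|x IH] xk; first by apply: left; lia.
have [_ e _] := tg k x ltac:(lia); have [_ e' _] := tg' k x ltac:(lia).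
by move: e; rewrite e' IH ?(ltnW xk) // => [/GRing.addIr //|]; lia.
Qed.

(** * Heights and cells of arrays as positions in the merged word *)

Lemma height_lt n i j k i' j' k' : (height n i j k < height n i' j' k')%R =
  (2 * (i * n) + 2 * j + k' < 2 * (i' * n) + 2 * j' + k).
Proof.
rewrite /height -(ltr_nat rat) !natrD !natrM.
by apply/idP/idP => h; lra.
Qed.

Section Cells.

Variable N : nat.
Local Notation n := N.+1.

Definition cell i j k : idx 3 n :=
  insubd (exist _ (ord0, ord0, ord0) (leqnn 0)) (inord i, inord j, inord k.-1).

Lemma val_cell i j k : i < 3 -> j < k <= n ->
  val (cell i j k) = (inord i, inord j, inord k.-1).
Proof.
move=> i3 jk; rewrite val_insubd /= !inordK; try lia.
by rewrite (_ : j <= k.-1) //; lia.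
Qed.

Lemma idx_cell i j k : i < 3 -> j < k <= n ->
  [/\ idx_i (cell i j k) = i.+1, idx_j (cell i j k) = j.+1 & idx_k (cell i j k) = k].
Proof.
move=> i3 jk; rewrite /idx_i /idx_j /idx_k val_cell //= !inordK; try lia.
by split; lia.
Qed.

Lemma cellP (c : idx 3 n) : exists i j k,
  [/\ i < 3, j < k <= n, c = cell i j k & [/\ idx_i c = i.+1, idx_j c = j.+1 & idx_k c = k]].
Proof.
case: c => [[[i j] k] jk]; exists i, j, k.+1; split => //.
  by have := ltn_ord k; move: jk => /=; lia.
apply: val_inj; rewrite val_cell //=; last by have := ltn_ord k; move: jk => /=; lia.
by rewrite !inord_val.
Qed.

Definition entry (T : array 3 n) i j k := T (cell i j k).

Lemma div3 k r : r < 3 * k -> r %/ k < 3.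
Proof. by case: k => [|k] rk; [lia | rewrite ltn_divLR]. Qed.

Lemma card_row (T : array 3 n) k a : 0 < k <= n ->
  #|[set c : idx 3 n | (idx_k c == k) && (T c == a)]| = Bn (entry T) k a (3 * k).
Proof.
move=> kn; pose F (r : 'I_(3 * k)) := cell (r %/ k) (r %% k) k.
have FE (r : 'I_(3 * k)) : [/\ idx_i (F r) = (r %/ k).+1, idx_j (F r) = (r %% k).+1 & idx_k (F r) = k].
  by apply: idx_cell; [exact: div3 | rewrite ltn_pmod; lia].
have Finj : injective F.
  move=> r s E; have [ri rj _] := FE r; have [si sj _] := FE s.
  apply: val_inj; rewrite /= (divn_eq r k) (divn_eq s k).
  by move: ri rj; rewrite E si sj => -[->] [->].
rewrite /Bn big_mkord -sum1_card.
transitivity #|F @: [set r : 'I_(3 * k) | word (entry T) k r == a]|; last first.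
  rewrite card_imset // -sum1_card big_mkcond /=.
  by apply: eq_bigr => r _; rewrite inE; case: eqP.
rewrite sum1_card; apply: eq_card => c; rewrite inE.
apply/andP/imsetP => [[/eqP ck /eqP Tc]|[r]]; last first.
  by rewrite inE => wr ->; have [_ _ ->] := FE r.
have [i [j [k' [i3 jk cE [_ _ ck']]]]] := cellP c.
rewrite ck' in ck; rewrite ck in jk cE; have jk' : j < k by lia.
have rk : i * k + j < 3 * k by case: i i3 {cE} => [|[|[|//]]]; lia.
exists (Ordinal rk); last first.
  by rewrite /F /= divnMDl ?modnMDl ?divn_small ?modn_small ?addn0 //; lia.
by rewrite inE /= wordE // /entry -cE Tc.
Qed.

Lemma height_row i j i' j' k : i < 3 -> i' < 3 -> j < k <= n -> j' < k ->
  (height n i.+1 j.+1 k < height n i'.+1 j'.+1 k)%R = (i * k + j < i' * k + j').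
Proof.
move=> i3 i3' jk jk'; rewrite height_lt.
by case: i i3 => [|[|[|//]]] _; case: i' i3' => [|[|[|//]]] _; lia.
Qed.

(** An entry of row [k.-1] lies half a unit above the entry of row [k] with the same indices, hence
    the non-strict inequality; [k <= n] keeps the blocks apart. *)
Lemma height_down i j i' j' k : i < 3 -> i' < 3 -> j < k <= n -> j' < k.-1 ->
  (height n i.+1 j.+1 k < height n i'.+1 j'.+1 k.-1)%R = (i * k + j <= i' * k + j').
Proof.
move=> i3 i3' jk jk'; rewrite height_lt.
by case: i i3 => [|[|[|//]]] _; case: i' i3' => [|[|[|//]]] _; lia.
Qed.

Lemma height_up i j i' j' k : i < 3 -> i' < 3 -> j < k <= n -> j' < k.-1 ->
  (height n i'.+1 j'.+1 k.-1 < height n i.+1 j.+1 k)%R = (i' * k + j' < i * k + j).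
Proof.
move=> i3 i3' jk jk'; rewrite height_lt.
by case: i i3 => [|[|[|//]]] _; case: i' i3' => [|[|[|//]]] _; lia.
Qed.

Lemma arrays_good (T : array 3 n) :
  reflect (forall k, k <= n -> good_row (entry T) k) (T \in interlacing_arrays 3 n).
Proof.
apply: (iffP idP) => [|good].
  rewrite inE => /andP[/'forall_forallP bal /'forall_forallP gap] [|k] kn.
    exact: good_row0.
  split=> [a|a r r' rr' wr wr'].
    by rewrite -card_row //; apply/eqP; apply: (bal (Ordinal kn) a).
  have k0 : 0 < k.+1 by [].
  have r3 : r %/ k.+1 < 3 by apply: div3; lia.
  have r3' : r' %/ k.+1 < 3 by apply: div3; lia.
  have rm := ltn_pmod r k0; have rm' := ltn_pmod r' k0.
  have := gap (cell (r %/ k.+1) (r %% k.+1) k.+1) (cell (r' %/ k.+1) (r' %% k.+1) k.+1).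
  have [ci cj ck] := @idx_cell (r %/ k.+1) (r %% k.+1) k.+1 ltac:(assumption) ltac:(lia).
  have [ci' cj' ck'] := @idx_cell (r' %/ k.+1) (r' %% k.+1) k.+1 ltac:(assumption) ltac:(lia).
  move: wr wr'; rewrite /word /entry => wr wr'.
  rewrite /idx_h ci cj ck ci' cj' ck' wr wr' !eqxx height_row //=; last lia.
  rewrite -!divn_eq (_ : r < r') /=; last lia.
  case/existsP => c''; have [i [j [l [i3 jl -> [-> -> ->]]]]] := cellP c''.
  case/and3P => [/eqP[lk] Tc /andP[h1 h2]]; subst l.
  exists (i * k.+1 + j); last by rewrite slotE; [rewrite /= Tc; lia | lia].
  move: h1 h2; rewrite (@height_down _ _ _ _ k.+1) //=; try lia.
  by rewrite (@height_up _ _ _ _ k.+1) //= -?divn_eq; lia.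
rewrite inE; apply/andP; split.
  apply/'forall_forallP => k a; have kn := ltn_ord k.
  by rewrite card_row //; have [-> _] := good k.+1 kn.
apply/'forall_forallP => c c'.
have [i [j [k [i3 jk cE [ci cj ck]]]]] := cellP c.
have [i' [j' [k' [i3' jk' cE' [ci' cj' ck']]]]] := cellP c'.
rewrite /idx_h ci cj ck ci' cj' {}ck'; apply/implyP => /and3P[/eqP kk /eqP TT].
subst k'; have jk2 : j' < k by lia.
have jk1 : j < k by lia.
rewrite height_row // => lt.
have [_ gap] := good k ltac:(lia).
have [l lr /andP[lk Tl]] : exists2 l, i * k + j <= l < i' * k + j' & slot (entry T) k (T c) l.
  apply: gap; rewrite ?wordE //.
  - by rewrite lt /=; case: i' i3' {cE' ci' lt} => [|[|[|//]]]; lia.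
  - by rewrite /entry -cE.
  - by rewrite /entry -cE'.
have l3 : l %/ k < 3.
  by apply: div3; case: i' i3' {cE' ci' lt} lr => [|[|[|//]]]; lia.
have lk' : l %% k < k.-1 <= n by lia.
have [li lj lk''] := idx_cell l3 lk'.
apply/existsP; exists (cell (l %/ k) (l %% k) k.-1).
rewrite li lj lk'' height_down ?height_up //; try lia.
by rewrite -!divn_eq lr Tl prednK ?eqxx //; lia.
Qed.

End Cells.

(** * Vertex colorings and the final count *)

Definition color_of (v : V) : 'I_4 := inord (v.1.*2 + v.2).
Definition vec_of (q : 'I_4) : V := (1 < q, odd q).

Lemma color_ofK : cancel color_of vec_of.
Proof. by case=> [[] []]; rewrite /color_of /vec_of /= inordK. Qed.

Lemma vec_ofK : cancel vec_of color_of.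
Proof.
by move=> q; apply: val_inj; case: q => [[|[|[|[|//]]]] lt]; rewrite /= inordK.
Qed.

Section Colorings.

Variable N : nat.
Local Notation n := N.+1.

Definition vert k x : vertex n :=
  insubd (exist _ (ord0, ord0) (leq0n n)) (inord x, inord (n - k)).

Lemma val_vert k x : x <= k <= n -> val (vert k x) = (inord x, inord (n - k)).
Proof.
move=> xk; rewrite val_insubd /= !inordK; try lia.
by rewrite (_ : x + (n - k) <= n) //; lia.
Qed.

Lemma coord_vert k x : x <= k <= n -> vx (vert k x) = x /\ vy (vert k x) = n - k.
Proof. by move=> xk; rewrite /vx /vy val_vert //= !inordK; lia.
Qed.

Lemma vertP (v : vertex n) : exists k x,
  [/\ x <= k <= n, v = vert k x, vx v = x & vy v = n - k].
Proof.
case: v => [[x y] /= xy]; exists (n - y), x.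
have y_le := ltn_ord y; have e : n - (n - y) = y by lia.
split=> //; first by lia.
apply: val_inj; rewrite val_vert /=; last by lia.
by rewrite e !inord_val.
Qed.

Definition grid_of (f : {ffun vertex n -> 'I_4}) k x : V := vec_of (f (vert k x)).

(** Every edge is a side of an upward unit triangle, with base from vertex [x] to [x.+1] of line [k]
    and apex at vertex [x] of line [k.-1]. *)
Lemma colorings_proper f :
  reflect (proper_grid (grid_of f) n) (f \in proper_colorings 4 n).
Proof.
have neq v w : (vec_of (f v) != vec_of (f w)) = (f v != f w).
  by rewrite (inj_eq (can_inj vec_ofK)).
rewrite inE; apply: (iffP 'forall_forallP) => [H k x xk | H v w].
  have [a1 a2] := @coord_vert k x ltac:(lia).
  have [b1 b2] := @coord_vert k x.+1 ltac:(lia).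
  have [c1 c2] := @coord_vert k.-1 x ltac:(lia).
  rewrite !neq; split; apply: implyP (H _ _) _;
    by rewrite /adj /step ?a1 ?a2 ?b1 ?b2 ?c1 ?c2; lia.
suff st v' w' : step v' w' -> f v' != f w'.
  by apply/implyP => /orP[/st // | /st]; rewrite eq_sym.
have [k [x [xk -> _ _]]] := vertP v'.
have [l [y [yl -> _ _]]] := vertP w'.
have [a1 a2] := coord_vert xk; have [b1 b2] := coord_vert yl.
rewrite /step a1 a2 b1 b2 -neq => /or3P[] /andP[/eqP e1 /eqP e2].
- have e : l = k by lia.
  by subst; have [] := H k x ltac:(lia).
- have e : l = k.-1 by lia.
  by subst; have [] := H k x ltac:(lia).
- have e : k = l.-1 by lia.
  by subst; rewrite eq_sym; have [] := H l x ltac:(lia).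
Qed.

Definition label (g : nat -> nat -> V) i j k : V :=
  match i with
  | 0 => g j.+1 0%N + g j 0%N
  | 1 => g k j.+1 + g k j
  | _ => g (k - j)%N (k - j)%N + g (k - j).-1%N (k - j).-1%N
  end%R.

Definition array_of (f : {ffun vertex n -> 'I_4}) : array 3 n :=
  [ffun c => psi (label (grid_of f) (idx_i c).-1 (idx_j c).-1 (idx_k c))].

Lemma array_of_labels f : proper_grid (grid_of f) n ->
  edge_labels (entry (array_of f)) (grid_of f) n.
Proof.
move=> gP k j jk.
have E i : i < 3 -> entry (array_of f) i j k = psi (label (grid_of f) i j k).
  by move=> i3; have [ci cj ck] := idx_cell i3 jk; rewrite /entry ffunE ci cj ck.
rewrite !E //; split; rewrite psiK //= -eq_addv.
- by have [_ h _] := gP j.+1 0 ltac:(lia).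
- by have [h _ _] := gP k j jk; rewrite eq_sym.
- have [_ _] := gP (k - j) (k - j).-1 ltac:(lia).
  by rewrite prednK //; lia.
Qed.

Definition encode f := (array_of f, grid_of f 0 0).

Lemma encode_inj : {in proper_colorings 4 n &, injective encode}.
Proof.
move=> f f' /colorings_proper/array_of_labels L /colorings_proper/array_of_labels L' E.
have eT : array_of f = array_of f' := congr1 fst E.
have e0 : grid_of f 0 0 = grid_of f' 0 0 := congr1 snd E.
rewrite eT in L; apply/ffunP => v.
have [k [x [xk -> _ _]]] := vertP v.
exact: can_inj vec_ofK _ _ (grid_unique L L' e0 xk).
Qed.

(** Every interlacing array occurs with every top color [c], through the coloring [grid]; the four
    choices of [c] give the factor 4. *)
Lemma encode_image : encode @: proper_colorings 4 n = setX (interlacing_arrays 3 n) [set: V].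
Proof.
apply/setP => -[T c]; rewrite in_setX in_setT andbT.
apply/imsetP/arrays_good => [[f /colorings_proper gP [-> _]]|good].
  exact: grid_good gP (array_of_labels gP).
pose g := grid (entry T) c; pose f := [ffun v : vertex n => color_of (g (n - vy v) (vx v))].
have gE k x : x <= k <= n -> grid_of f k x = g k x.
  move=> xk; have [ex ey] := coord_vert xk.
  by rewrite /grid_of ffunE color_ofK ex ey subKn //; lia.
have gP : proper_grid (grid_of f) n.
  move=> k x xk; rewrite !gE; try lia.
  exact: grid_proper good _ _ xk.
have gl := grid_labels c good.
exists f; first exact/colorings_proper.
congr (_, _); last by rewrite gE // /g grid00.
apply/ffunP => a; have [i [j [k [i3 jk aE _]]]] := cellP a.
have [l0 l1 l2] := array_of_labels gP jk.
have [m0 m1 m2] := gl k j jk.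
rewrite aE -/(entry T i j k) -/(entry (array_of f) i j k); apply: phi_inj.
case: i i3 {aE} => [|[|[|//]]] _.
- by rewrite l0 m0 !gE //; lia.
- by rewrite l1 m1 !gE //; lia.
- by rewrite l2 m2 !gE //; lia.
Qed.

End Colorings.

Theorem mainTheorem2 (n : nat) (hn : (1 <= n)%N) :
  (#|interlacing_arrays 3 n|%:R = 1 / 4 * #|proper_colorings 4 n|%:R :> rat)%R.
Proof.
case: n hn => [//|N] _.
rewrite -(card_in_imset (@encode_inj N)) encode_image cardsX cardsT card_prod card_bool.
by rewrite natrM; lra.
Qed.
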